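(* Let $R=\mathbb{Z}_N[\mathbb{Z}^D]$ and let $$F_2\xrightarrow{\;d_2\;}F_1\xrightarrow{\;d_1\;}F_0$$ be a sequence of finite-rank free $R$-modules and $R$-linear maps, exact at $F_1$ (i.e. $\operatorname{im} d_2=\ker d_1$). Then $$\ker d_2^\dagger = F_1^\dagger\cap \operatorname{im} d_1^*,$$ where the intersection is taken inside $F_1^*$ via the natural embedding $F_1^\dagger\hookrightarrow F_1^*$. Consequently, the module of superselection sectors, defined as the quotient $(F_1^\dagger\cap \operatorname{im} d_1^* )/\operatorname{im} d_1^\dagger$, satisfies $$\frac{F_1^\dagger\cap \operatorname{im} d_1^*}{\operatorname{im} d_1^\dagger}\;\cong_R\;\operatorname{Ext}_R^1\bigl(\overline{\operatorname{coker} d_1},R\bigr).$$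
   Context: $\mathbb Z_N=\mathbb Z/N\mathbb Z$ and $R=\mathbb Z_N[\mathbb Z^D]=\mathbb Z_N[x_1^{\pm1},\dots,x_D^{\pm1}]$, with $\mathbb Z_N$-linear involution $\overline{x^{\mathbf v}}=x^{-\mathbf v}$. For an $R$-module $M$, $\overline M$ is the same abelian group with action $r\ast m=\overline r\,m$. $\cong_R$ denotes isomorphism of $R$-modules. For a finite-rank free $R$-module $F$: - the dagger dual is $F^\dagger=\operatorname{Hom}_R(\overline F,R)$, i.e. additive maps $\lambda:F\to R$ with $\lambda(rm)=\overline r\,\lambda(m)$, with $R$-action $(r\cdot\lambda)(m)=r\lambda(m)$; - the full dual is $F^*=\operatorname{Hom}_{\mathbb Z_N}(F,\mathbb Z_N)$ with $R$-action $(r\cdot\lambda)(m)=\lambda(\overline r\,m)$. For an $R$-linear map $d:F\to F'$, $d^\dagger:F'^\dagger\to F^\dagger$ and $d^*:F'^*\to F^*$ are given by precomposition with $d$. Let $\operatorname{tr}:R\to\mathbb Z_N$ extract the coefficient of $x^{\mathbf 0}$. The natural embedding $F^\dagger\hookrightarrow F^*$ is $\lambda\mapsto\operatorname{tr}\circ\lambda$; it is $R$-linear and $d^\dagger$ is the restriction of $d^*$ under it. *)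

(* Defs.v *)
From HB Require Import structures.
From mathcomp Require Import all_boot all_order all_algebra.
From mathcomp Require Import boolp finmap.
From mathcomp.multinomials Require Import monalg.

Set Implicit Arguments.
Unset Strict Implicit.
Unset Printing Implicit Defensive.

Import GRing.Theory.
Local Open Scope fset_scope.
Local Open Scope ring_scope.
Local Open Scope quotient_scope.

(* ['Z_N] is Z/2Z for N = 1, so we use ['I_N.-1.+1] with the operations of     *)
(* zmodp; this is Z/NZ for every N > 0, the zero ring for N = 1 included.       *)
Definition Zmod (N : nat) : Type := 'I_N.-1.+1.
HB.instance Definition _ N := Finite.on (Zmod N).
HB.instance Definition _ N := GRing.Zmodule.on (Zmod N).
HB.instance Definition _ N := @GRing.Zmodule_isComPzRing.Build (Zmod N) (@Zp1 N.-1)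
  (@Zp_mul _) (@Zp_mulA _) (@Zp_mulC _) (@Zp_mul1z _) (@Zp_mul_addl _).

(* The free module S^(T) on a set T; ring coefficients in monalg are nonzero    *)
(* rings, so the scalar action is defined here.                                 *)
Definition freemod (S : pzRingType) (T : choiceType) : Type := {malg S[T]}.
HB.instance Definition _ (S : pzRingType) (T : choiceType) :=
  GRing.Zmodule.on (freemod S T).

Section FreeModule.
Context (S : pzRingType) (T : choiceType).
Implicit Types (g h : freemod S T) (k : T) (c : S).

Definition fm_scale c g : freemod S T := \sum_(k <- msupp g) << c * g@_k *g k >>.

Lemma fm_scaleE c g k : (fm_scale c g)@_k = c * g@_k.
Proof.
rewrite {2}[g]monalgE !raddf_sum mulr_sumr.
by apply/eq_bigr=> /= i _; rewrite !mcoeffU mulrnAr.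
Qed.

Lemma fm_scaleA c1 c2 g : fm_scale c1 (fm_scale c2 g) = fm_scale (c1 * c2) g.
Proof. by apply/malgP=> x; rewrite !fm_scaleE mulrA. Qed.

Lemma fm_scale1 : left_id 1 fm_scale.
Proof. by move=> g; apply/malgP=> k; rewrite !fm_scaleE mul1r. Qed.

Lemma fm_scaleDr : right_distributive fm_scale +%R.
Proof. by move=> c g h; apply/malgP=> k; rewrite !(mcoeffD, fm_scaleE) mulrDr. Qed.

Lemma fm_scaleDl g : {morph fm_scale^~ g : a b / a + b}.
Proof. by move=> a b; apply/malgP=> k; rewrite !(mcoeffD, fm_scaleE) mulrDl. Qed.

HB.instance Definition _ := GRing.Zmodule_isLmodule.Build S (freemod S T)
  fm_scaleA fm_scale1 fm_scaleDr fm_scaleDl.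

End FreeModule.

(* The group algebra K[G] of an abelian group G, written additively: << c *g v >> *)
(* is the element c x^v, and g@_v is the coefficient of x^v in g. monalg only     *)
(* provides the product for index monoids in which 1 is the only unit.           *)
Definition grpalg (K : comPzRingType) (G : zmodType) : Type := freemod K G.
HB.instance Definition _ (K : comPzRingType) (G : zmodType) :=
  GRing.Zmodule.on (grpalg K G).

Section GroupAlgebra.
Context (K : comPzRingType) (G : zmodType).
Implicit Types (f g h : grpalg K G) (v w : G) (c : K).

Definition ga_one : grpalg K G := << (1 : K) *g (0 : G) >>.

Definition ga_mul g h : grpalg K G :=
  \sum_(v <- msupp g) \sum_(w <- msupp h) << g@_v * h@_w *g (v + w) >>.

Lemma ga_mulw (d1 d2 : {fset G}) g h :
  msupp g `<=` d1 -> msupp h `<=` d2 ->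
  ga_mul g h = \sum_(v <- d1) \sum_(w <- d2) << g@_v * h@_w *g (v + w) >>.
Proof.
move=> le_d1 le_d2; rewrite /ga_mul (big_fset_incl _ le_d1) /=.
  apply/eq_bigr=> k1 _; apply/big_fset_incl => // k _ /mcoeff_outdom ->.
  by rewrite mulr0 monalgU0.
move=> k _ /mcoeff_outdom g1k.
by rewrite big1 => // k' _; rewrite g1k mul0r monalgU0.
Qed.

Lemma ga_mulC : commutative ga_mul.
Proof.
move=> g h; rewrite /ga_mul exchange_big; apply/eq_bigr=> v _.
by apply/eq_bigr=> w _; rewrite mulrC addrC.
Qed.

Lemma ga_mul0 : left_zero 0 ga_mul.
Proof. by move=> g; rewrite /ga_mul msupp0 big_seq_fset0. Qed.

Lemma ga_mulUg c v g :
  ga_mul << c *g v >> g = \sum_(w <- msupp g) << c * g@_w *g (v + w) >>.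
Proof.
rewrite (ga_mulw msuppU_le (fsubset_refl _)) big_seq_fset1.
by apply/eq_bigr => k' _; rewrite mcoeffUU.
Qed.

Lemma ga_mulUU c1 c2 v w :
  ga_mul << c1 *g v >> << c2 *g w >> = << c1 * c2 *g (v + w) >>.
Proof. by rewrite (ga_mulw msuppU_le msuppU_le) !big_seq_fset1 !mcoeffUU. Qed.

Lemma ga_mul1 : left_id ga_one ga_mul.
Proof.
move=> g; rewrite ga_mulUg [RHS]monalgE.
by apply/eq_bigr=> v _; rewrite mul1r add0r.
Qed.

Lemma ga_mulDl : left_distributive ga_mul +%R.
Proof.
move=> g1 g2 g.
rewrite [in RHS](ga_mulw (fsubsetUl _ (msupp g2)) (fsubset_refl _)).
rewrite [in RHS](ga_mulw (fsubsetUr (msupp g1) _) (fsubset_refl _)).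
rewrite (ga_mulw (msuppD_le _ _) (fsubset_refl _)).
rewrite -big_split /=; apply/eq_bigr=> k1 _.
rewrite -big_split /=; apply/eq_bigr=> k2 _.
by rewrite mcoeffD mulrDl monalgUD.
Qed.

Lemma ga_mul_suml I (r : seq I) (F : I -> grpalg K G) h :
  ga_mul (\sum_(i <- r) F i) h = \sum_(i <- r) ga_mul (F i) h.
Proof. exact: (big_morph (ga_mul^~ h) (fun _ _ => ga_mulDl _ _ _) (ga_mul0 _)). Qed.

Lemma ga_mul_sumr I (r : seq I) (F : I -> grpalg K G) h :
  ga_mul h (\sum_(i <- r) F i) = \sum_(i <- r) ga_mul h (F i).
Proof.
by rewrite ga_mulC ga_mul_suml; apply/eq_bigr=> i _; rewrite ga_mulC.
Qed.

Lemma ga_mulA : associative ga_mul.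
Proof.
move=> f g h; rewrite [f]monalgE (ga_mul_suml _ _ g) 2!ga_mul_suml.
apply/eq_bigr=> u _; rewrite [g]monalgE (ga_mul_suml _ _ h) 2!ga_mul_sumr.
rewrite ga_mul_suml; apply/eq_bigr=> v _.
rewrite [h]monalgE (ga_mul_sumr _ _ << g@_v *g v >>) 2!ga_mul_sumr.
apply/eq_bigr=> w _.
by rewrite !ga_mulUU mulrA addrA.
Qed.

HB.instance Definition _ := GRing.Zmodule_isComPzRing.Build (grpalg K G)
  ga_mulA ga_mulC ga_mul1 ga_mulDl.

Definition ga_const c : grpalg K G := << c *g (0 : G) >>.

Lemma ga_const_is_zmod_morphism : zmod_morphism ga_const.
Proof. by move=> a b; rewrite /ga_const monalgUB. Qed.
Lemma ga_const_is_monoid_morphism : monoid_morphism ga_const.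
Proof. by split=> // a b; rewrite /ga_const [RHS]ga_mulUU addr0. Qed.
HB.instance Definition _ :=
  GRing.isZmodMorphism.Build K (grpalg K G) ga_const ga_const_is_zmod_morphism.
HB.instance Definition _ :=
  GRing.isMonoidMorphism.Build K (grpalg K G) ga_const ga_const_is_monoid_morphism.

Definition ga_conj g : grpalg K G := \sum_(v <- msupp g) << g@_v *g (- v) >>.

Lemma ga_conjE g v : (ga_conj g)@_v = g@_(- v).
Proof.
rewrite [in RHS](monalgE g) /ga_conj !raddf_sum; apply/eq_bigr=> /= w _.
by rewrite !mcoeffU eqr_oppLR.
Qed.

Lemma ga_conjU c v : ga_conj << c *g v >> = << c *g (- v) >>.
Proof. by apply/malgP=> w; rewrite ga_conjE !mcoeffU eqr_oppLR. Qed.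

Lemma ga_conj_is_zmod_morphism : zmod_morphism ga_conj.
Proof. by move=> g h; apply/malgP=> v; rewrite mcoeffB !ga_conjE mcoeffB. Qed.
HB.instance Definition _ := GRing.isZmodMorphism.Build _ _ ga_conj
  ga_conj_is_zmod_morphism.

Lemma ga_conj_is_monoid_morphism : monoid_morphism ga_conj.
Proof.
split=> [|g h]; first by rewrite [LHS]ga_conjU oppr0.
rewrite [g]monalgE [h]monalgE.
rewrite [X in ga_conj X]ga_mul_suml !raddf_sum [RHS]ga_mul_suml.
apply/eq_bigr=> v _; rewrite ga_mul_sumr raddf_sum [RHS]ga_mul_sumr.
by apply/eq_bigr=> w _; rewrite ga_mulUU /= !ga_conjU ga_mulUU opprD.
Qed.
HB.instance Definition _ := GRing.isMonoidMorphism.Build _ _ ga_conj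
  ga_conj_is_monoid_morphism.

Lemma ga_conjK : involutive ga_conj.
Proof. by move=> g; apply/malgP=> v; rewrite !ga_conjE opprK. Qed.

Lemma ga_conj_const c : ga_conj (ga_const c) = ga_const c.
Proof. by rewrite ga_conjU oppr0. Qed.

Definition ga_tr g : K := g@_0.

Lemma ga_tr_is_zmod_morphism : zmod_morphism ga_tr.
Proof. by move=> g h; rewrite /ga_tr mcoeffB. Qed.
HB.instance Definition _ := GRing.isZmodMorphism.Build _ _ ga_tr
  ga_tr_is_zmod_morphism.

Lemma ga_tr_const c g : ga_tr (ga_const c * g) = c * ga_tr g.
Proof.
rewrite /ga_tr [in RHS](monalgE g) [ga_const c * g]ga_mulUg.
rewrite !raddf_sum mulr_sumr.
by apply/eq_bigr=> /= w _; rewrite !mcoeffU add0r mulrnAr.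
Qed.

End GroupAlgebra.

Section LinearMaps.
Context (S : comPzRingType) (U V : lmodType S).
Implicit Types (f g h : {linear U -> V}) (a b : S).

HB.instance Definition _ := gen_eqMixin {linear U -> V}.
HB.instance Definition _ := gen_choiceMixin {linear U -> V}.

Lemma linP f g : f =1 g -> f = g.
Proof.
case: f g => [f [[Af] [Sf]]] [g [[Ag] [Sg]]] /= /funext fg.
rewrite {}fg in Af Sf *.
by congr (GRing.Linear.Pack (GRing.Linear.Class _ _)); congr (_ _);
   apply: Prop_irrelevance.
Qed.

Definition lin_zero : {linear U -> V} := \0.
Definition lin_opp f : {linear U -> V} := \- f.
Definition lin_add f g : {linear U -> V} := f \+ g.
Definition lin_scale a f : {linear U -> V} := a \*: f.

Lemma lin_addA : associative lin_add.
Proof. by move=> f g h; apply: linP => x /=; rewrite addrA. Qed.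
Lemma lin_addC : commutative lin_add.
Proof. by move=> f g; apply: linP => x /=; rewrite addrC. Qed.
Lemma lin_add0 : left_id lin_zero lin_add.
Proof. by move=> f; apply: linP => x /=; rewrite add0r. Qed.
Lemma lin_addN : left_inverse lin_zero lin_opp lin_add.
Proof. by move=> f; apply: linP => x /=; rewrite addNr. Qed.
HB.instance Definition _ := GRing.isZmodule.Build {linear U -> V}
  lin_addA lin_addC lin_add0 lin_addN.

Lemma lin_scaleA a b f : lin_scale a (lin_scale b f) = lin_scale (a * b) f.
Proof. by apply: linP => x /=; rewrite scalerA. Qed.
Lemma lin_scale1 : left_id 1 lin_scale.
Proof. by move=> f; apply: linP => x /=; rewrite scale1r. Qed.
Lemma lin_scaleDr : right_distributive lin_scale +%R.
Proof. by move=> a f g; apply: linP => x /=; rewrite scalerDr. Qed.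
Lemma lin_scaleDl f : {morph lin_scale^~ f : a b / a + b}.
Proof. by move=> a b; apply: linP => x /=; rewrite scalerDl. Qed.
HB.instance Definition _ := GRing.Zmodule_isLmodule.Build S {linear U -> V}
  lin_scaleA lin_scale1 lin_scaleDr lin_scaleDl.

End LinearMaps.

Section Precomposition.
Context (S : comPzRingType) (U V W : lmodType S) (d : {linear U -> V}).

Definition precomp (f : {linear V -> W}) : {linear U -> W} := f \o d.

Lemma precomp_is_linear : linear precomp.
Proof. by move=> a f g; apply: linP. Qed.
HB.instance Definition _ := GRing.isLinear.Build S _ _ _ precomp precomp_is_linear.

End Precomposition.

Record submodule (S : pzRingType) (V : lmodType S) := Submodule {
  submod_pred :> {pred V};
  submod_pred_closed : subsemimod_closed submod_pred }.

HB.instance Definition _ (S : pzRingType) (V : lmodType S) (A : submodule V) :=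
  GRing.isSubmodClosed.Build S V (submod_pred A) (submod_pred_closed A).

Section Submodules.
Context (S : pzRingType) (U V : lmodType S).
Implicit Types (A B : submodule V) (f : {linear U -> V}).

Lemma submod0_closed : subsemimod_closed (pred1 (0 : V)).
Proof.
split; first split; rewrite ?inE //.
  by move=> x y; rewrite !inE => /eqP-> /eqP->; rewrite addr0.
by move=> a x; rewrite !inE => /eqP->; rewrite scaler0.
Qed.
Definition submod0 : submodule V := Submodule submod0_closed.

Lemma submodT_closed : subsemimod_closed (predT : {pred V}).
Proof. by []. Qed.
Definition submodT : submodule V := Submodule submodT_closed.

Lemma submod_ker_closed f : subsemimod_closed [pred x | f x == 0].
Proof.
split; first split; rewrite ?inE ?raddf0 //.
  by move=> x y; rewrite !inE => /eqP fx /eqP fy; rewrite raddfD /= fx fy addr0.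
by move=> a x; rewrite !inE => /eqP fx; rewrite linearZ /= fx scaler0.
Qed.
Definition submod_ker f : submodule U := Submodule (submod_ker_closed f).

Lemma submod_image_closed f (A : submodule U) :
  subsemimod_closed [pred y | `[< exists2 x, x \in A & f x = y >]].
Proof.
split; first split; rewrite ?inE.
- by apply/asboolP; exists 0; rewrite ?rpred0 ?raddf0.
- move=> y z; rewrite !inE => /asboolP[v Av <-] /asboolP[w Aw <-].
  by apply/asboolP; exists (v + w); rewrite ?rpredD ?raddfD.
- move=> a y; rewrite !inE => /asboolP[v Av <-]; apply/asboolP.
  by exists (a *: v); rewrite ?rpredZ ?linearZ.
Qed.
Definition submod_image f (A : submodule U) : submodule V := Submodule (submod_image_closed f A).

Lemma submod_cap_closed A B : subsemimod_closed [predI A & B].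
Proof.
split; first split; rewrite ?inE ?rpred0 //.
  by move=> x y; rewrite !inE => /andP[? ?] /andP[? ?]; rewrite !rpredD.
by move=> a x; rewrite !inE => /andP[? ?]; rewrite !rpredZ.
Qed.
Definition submod_cap A B : submodule V := Submodule (submod_cap_closed A B).

End Submodules.

Definition submod_range (S : pzRingType) (U V : lmodType S) (f : {linear U -> V}) :
  submodule V := submod_image f (submodT U).

Section SubmoduleType.
Context (S : pzRingType) (V : lmodType S) (A : submodule V).

Record submod_type : Type := SubmodElt { submod_val : V; _ : submod_val \in A }.
HB.instance Definition _ := [isSub for submod_val].
HB.instance Definition _ := [Choice of submod_type by <:].
HB.instance Definition _ := [SubChoice_isSubZmodule of submod_type by <:].
HB.instance Definition _ := [SubZmodule_isSubLmodule of submod_type by <:].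

Definition submod_inj : {linear submod_type -> V} := \val.

Lemma submod_restr_closed (B : submodule V) :
  subsemimod_closed [pred x : submod_type | submod_inj x \in B].
Proof.
split; first split; rewrite ?inE ?raddf0 ?rpred0 //.
  by move=> x y; rewrite !inE raddfD => Bx By; rewrite rpredD.
by move=> a x; rewrite !inE linearZ => Bx; rewrite rpredZ.
Qed.
Definition submod_restr (B : submodule V) : submodule submod_type :=
  Submodule (submod_restr_closed B).

End SubmoduleType.

Section QuotientModule.
Context (S : pzRingType) (V : lmodType S) (A : submodule V).

Definition quotmod : Type := Quotient.quot A.
HB.instance Definition _ := GRing.Zmodule.on quotmod.
HB.instance Definition _ := EqQuotient.on quotmod.

Definition qm_pi (x : V) : quotmod := \pi_quotmod x.
Definition qm_scale (a : S) (q : quotmod) : quotmod := qm_pi (a *: repr q).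

Lemma qm_pi_eq x y : qm_pi x = qm_pi y <-> x - y \in A.
Proof. by rewrite Quotient.idealrBE; split=> [/eqP|/eqP]. Qed.

Lemma qm_piK : cancel (repr : quotmod -> V) qm_pi.
Proof. exact: reprK. Qed.

Lemma qm_pi_is_zmod_morphism : zmod_morphism qm_pi.
Proof. by move=> x y; rewrite /qm_pi !piE. Qed.
HB.instance Definition _ :=
  GRing.isZmodMorphism.Build V quotmod qm_pi qm_pi_is_zmod_morphism.

Lemma qm_scale_pi a x : qm_scale a (qm_pi x) = qm_pi (a *: x).
Proof.
by apply/qm_pi_eq; rewrite -scalerBr rpredZ //; apply/qm_pi_eq; rewrite qm_piK.
Qed.

Lemma qm_scaleA a b q : qm_scale a (qm_scale b q) = qm_scale (a * b) q.
Proof. by rewrite -(qm_piK q) !qm_scale_pi scalerA. Qed.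
Lemma qm_scale1 : left_id 1 qm_scale.
Proof. by move=> q; rewrite -(qm_piK q) qm_scale_pi scale1r. Qed.
Lemma qm_scaleDr : right_distributive qm_scale +%R.
Proof.
move=> a p q; rewrite -(qm_piK p) -(qm_piK q) -raddfD !qm_scale_pi.
by rewrite scalerDr raddfD.
Qed.
Lemma qm_scaleDl q : {morph qm_scale^~ q : a b / a + b}.
Proof. by move=> a b; rewrite -(qm_piK q) !qm_scale_pi scalerDl raddfD. Qed.
HB.instance Definition _ := GRing.Zmodule_isLmodule.Build S quotmod
  qm_scaleA qm_scale1 qm_scaleDr qm_scaleDl.

Lemma qm_pi_is_scalable : scalable qm_pi.
Proof. by move=> a x; rewrite -qm_scale_pi. Qed.
HB.instance Definition _ := GRing.isScalable.Build S V quotmod *:%R qm_pi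
  qm_pi_is_scalable.

End QuotientModule.

(* A / (A \cap B); only used for B contained in A *)
Definition subquot (S : pzRingType) (V : lmodType S) (A B : submodule V) : lmodType S :=
  quotmod (submod_restr A B).

Definition coker (S : pzRingType) (U V : lmodType S) (f : {linear U -> V}) : lmodType S :=
  quotmod (submod_range f).

Definition lmod_iso (S : pzRingType) (U V : lmodType S) : Prop :=
  exists f : {linear U -> V}, bijective f.

Definition exact_at (S : pzRingType) (U V W : lmodType S)
    (f : {linear U -> V}) (g : {linear V -> W}) : Prop := submod_range f =i submod_ker g.

Definition finite_free (S : pzRingType) (F : lmodType S) : Prop :=
  exists n (b : 'I_n -> F), bijective (fun c : 'rV[S]_n => \sum_i c 0 i *: b i).

Definition projective (S : pzRingType) (P : lmodType S) : Prop :=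
  forall (U V : lmodType S) (g : {linear U -> V}) (f : {linear P -> V}),
  (forall y, exists x, g x = y) -> exists h : {linear P -> U}, g \o h =1 f.

Record proj_resolution (S : pzRingType) (M : lmodType S) := ProjResolution {
  pr_mod :> nat -> lmodType S;
  pr_diff : forall n, {linear pr_mod n.+1 -> pr_mod n};
  pr_aug : {linear pr_mod 0 -> M};
  pr_projective : forall n, projective (pr_mod n);
  pr_aug_surj : forall m, exists x, pr_aug x = m;
  pr_exact0 : exact_at (pr_diff 0) pr_aug;
  pr_exact : forall n, exact_at (pr_diff n.+1) (pr_diff n) }.

(* Ext^n_S(M, N) = H^n (Hom_S(P, N)) for a projective resolution P of M *)
Section Ext.
Context (S : comPzRingType) (M : lmodType S) (P : proj_resolution M) (N : lmodType S).

Definition ext_diff n : {linear {linear P n -> N} -> {linear P n.+1 -> N}} :=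
  precomp (pr_diff P n).

Definition ext_bound n : submodule {linear P n -> N} :=
  match n with
  | 0 => submod0 _
  | n.+1 => submod_range (ext_diff n)
  end.

Definition Ext n : lmodType S := subquot (submod_ker (ext_diff n)) (ext_bound n).

End Ext.

Section FreeResolution.
Context (S : pzRingType).

Section Extension.
Context (T : choiceType) (U : lmodType S) (s : T -> U).

Definition fm_ext (x : freemod S T) : U := \sum_(t <- msupp x) x@_t *: s t.

Lemma fm_extw (d : {fset T}) x : msupp x `<=` d ->
  fm_ext x = \sum_(t <- d) x@_t *: s t.
Proof.
move=> le_d; rewrite /fm_ext; apply/big_fset_incl => // t _ /mcoeff_outdom ->.
by rewrite scale0r.
Qed.

Lemma fm_ext_is_linear : linear fm_ext.
Proof.
move=> a x y; pose d := msupp (a *: x + y) `|` (msupp x `|` msupp y).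
rewrite (@fm_extw d); last exact: fsubsetUl.
rewrite (@fm_extw d x); last by rewrite /d fsetUCA fsubsetUl.
rewrite (@fm_extw d y); last by rewrite /d fsetUA fsubsetUr.
rewrite scaler_sumr -big_split; apply/eq_bigr => t _ /=.
by rewrite mcoeffD fm_scaleE scalerDl scalerA.
Qed.
HB.instance Definition _ := GRing.isLinear.Build S (freemod S T) U *:%R fm_ext
  fm_ext_is_linear.

Lemma fm_extU t : fm_ext << (1 : S) *g t >> = s t.
Proof. by rewrite (fm_extw msuppU_le) big_seq_fset1 mcoeffUU scale1r. Qed.

Lemma fm_span (f : {linear freemod S T -> U}) x :
  f x = \sum_(t <- msupp x) x@_t *: f << (1 : S) *g t >>.
Proof.
rewrite [in LHS](monalgE x) raddf_sum; apply/eq_bigr => t _.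
rewrite -linearZ; congr (f _); apply/malgP=> u.
by rewrite fm_scaleE !mcoeffU mulrnAr mulr1.
Qed.

End Extension.

Lemma freemod_projective (T : choiceType) : projective (freemod S T).
Proof.
move=> U V g f gsurj.
have /choice[s gs] : forall t, exists x, g x = f << (1 : S) *g t >>.
  by move=> t; apply: gsurj.
exists (fm_ext s) => x /=; rewrite (fm_span f) /fm_ext linear_sum.
by apply/eq_bigr => t _; rewrite linearZ /= gs.
Qed.

Definition fm_cover (M : lmodType S) : {linear freemod S M -> M} := fm_ext id.

Lemma proj_resolution_exists (M : lmodType S) : inhabited (proj_resolution M).
Proof.
pose K := fix K n : lmodType S :=
  if n is n.+1 then submod_type (submod_ker (fm_cover (K n))) else M.
pose d n : {linear freemod S (K n.+1) -> freemod S (K n)} :=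
  submod_inj (submod_ker (fm_cover (K n))) \o fm_cover (K n.+1).
have surj (N : lmodType S) y : exists x, fm_cover N x = y.
  by exists << (1 : S) *g y >>; rewrite /fm_cover /= fm_extU.
have dE n : submod_range (d n) =i submod_ker (fm_cover (K n)).
  move=> x; apply/idP/idP.
    by rewrite !inE => /asboolP[y _ <-]; exact: (valP (fm_cover (K n.+1) y)).
  move=> kx; have [y yx] := surj (K n.+1) (SubmodElt kx).
  by rewrite inE; apply/asboolP; exists y; rewrite // /d /= [fm_ext _ _]yx.
constructor; apply: (@ProjResolution _ _ (fun n => freemod S (K n)) d (fm_cover M)).
- by move=> n; apply: freemod_projective.
- exact: surj.
- exact: (dE 0).
- move=> n x; apply: (etrans (dE n.+1 x)); apply/eqP/eqP => kx.
    by rewrite (_ : d n x = submod_inj _ (fm_cover (K n.+1) x)) // kx raddf0.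
  by apply: val_inj; exact: kx.
Qed.

End FreeResolution.

Section Duals.
Context (K : comPzRingType) (G : zmodType).
Local Notation R := (grpalg K G).

Definition conjmod (F : lmodType R) : Type := F.

Section ConjMod.
Context (F : lmodType R).
HB.instance Definition _ := GRing.Zmodule.on (conjmod F).

Definition cm_scale (r : R) (m : conjmod F) : conjmod F := ga_conj r *: (m : F).

Lemma cm_scaleA a b m : cm_scale a (cm_scale b m) = cm_scale (a * b) m.
Proof. by rewrite /cm_scale scalerA rmorphM. Qed.
Lemma cm_scale1 : left_id 1 cm_scale.
Proof. by move=> m; rewrite /cm_scale rmorph1 scale1r. Qed.
Lemma cm_scaleDr : right_distributive cm_scale +%R.
Proof. by move=> a m n; rewrite /cm_scale scalerDr. Qed.
Lemma cm_scaleDl m : {morph cm_scale^~ m : a b / a + b}.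
Proof. by move=> a b; rewrite /cm_scale rmorphD scalerDl. Qed.
HB.instance Definition _ := GRing.Zmodule_isLmodule.Build R (conjmod F)
  cm_scaleA cm_scale1 cm_scaleDr cm_scaleDl.

Lemma conjmodE (r : R) (m : conjmod F) : r *: m = ga_conj r *: (m : F) :> F.
Proof. by []. Qed.
End ConjMod.

Definition resmod (F : lmodType R) : Type := F.

Section ResMod.
Context (F : lmodType R).
HB.instance Definition _ := GRing.Zmodule.on (resmod F).

Definition rm_scale (c : K) (m : resmod F) : resmod F := ga_const G c *: (m : F).

Lemma rm_scaleA a b m : rm_scale a (rm_scale b m) = rm_scale (a * b) m.
Proof. by rewrite /rm_scale scalerA rmorphM. Qed.
Lemma rm_scale1 : left_id 1 rm_scale.
Proof. by move=> m; rewrite /rm_scale rmorph1 scale1r. Qed.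
Lemma rm_scaleDr : right_distributive rm_scale +%R.
Proof. by move=> a m n; rewrite /rm_scale scalerDr. Qed.
Lemma rm_scaleDl m : {morph rm_scale^~ m : a b / a + b}.
Proof. by move=> a b; rewrite /rm_scale rmorphD scalerDl. Qed.
HB.instance Definition _ := GRing.Zmodule_isLmodule.Build K (resmod F)
  rm_scaleA rm_scale1 rm_scaleDr rm_scaleDl.

Lemma resmodE (c : K) (m : resmod F) : c *: m = ga_const G c *: (m : F) :> F.
Proof. by []. Qed.
End ResMod.

Definition dagger (F : lmodType R) : lmodType R := {linear conjmod F -> R^o}.

(* Hom_K(F, K) is wrapped because {linear _ -> _} carries the pointwise K-action, *)
(* while the R-action here is (r l)(m) = l (conj(r) m).                           *)
Definition fulldual (F : lmodType R) : Type := {linear resmod F -> K^o}.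

Section FullDual.
Context (F : lmodType R).
HB.instance Definition _ := GRing.Zmodule.on (fulldual F).

Section Scale.
Context (r : R) (l : fulldual F).
Definition fd_scale_fun (m : resmod F) : K^o :=
  (l : {linear resmod F -> K^o}) (ga_conj r *: (m : F)).
Lemma fd_scale_is_linear : linear fd_scale_fun.
Proof.
move=> c m n; rewrite /fd_scale_fun scalerDr.
have -> : ga_conj r *: ((c *: m : resmod F) : F) =
    c *: (ga_conj r *: (m : F) : resmod F) :> resmod F.
  by rewrite !resmodE !scalerA mulrC.
exact: (linearP (l : {linear resmod F -> K^o})).
Qed.
HB.instance Definition _ := GRing.isLinear.Build K (resmod F) K^o *:%R fd_scale_fun
  fd_scale_is_linear.
Definition fd_scale : fulldual F := (fd_scale_fun : {linear _ -> _}).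
End Scale.

Lemma fd_scaleA a b l : fd_scale a (fd_scale b l) = fd_scale (a * b) l.
Proof.
by apply: linP => m /=; rewrite /fd_scale_fun /= /fd_scale_fun scalerA mulrC rmorphM.
Qed.
Lemma fd_scale1 : left_id 1 fd_scale.
Proof. by move=> l; apply: linP => m /=; rewrite /fd_scale_fun rmorph1 scale1r. Qed.
Lemma fd_scaleDr : right_distributive fd_scale +%R.
Proof. by move=> a l l'; apply: linP. Qed.
Lemma fd_scaleDl l : {morph fd_scale^~ l : a b / a + b}.
Proof.
by move=> a b; apply: linP => m /=; rewrite /fd_scale_fun rmorphD scalerDl raddfD.
Qed.
HB.instance Definition _ := GRing.Zmodule_isLmodule.Build R (fulldual F)
  fd_scaleA fd_scale1 fd_scaleDr fd_scaleDl.
End FullDual.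

Section DualMaps.
Context (F F' : lmodType R) (d : {linear F -> F'}).

Definition conj_map (m : conjmod F) : conjmod F' := d m.
Lemma conj_map_is_linear : linear conj_map.
Proof. by move=> r m n; apply: (linearP d). Qed.
HB.instance Definition _ := GRing.isLinear.Build R _ _ _ conj_map conj_map_is_linear.

Definition res_map (m : resmod F) : resmod F' := d m.
Lemma res_map_is_linear : linear res_map.
Proof. by move=> r m n; apply: (linearP d). Qed.
HB.instance Definition _ := GRing.isLinear.Build K _ _ _ res_map res_map_is_linear.

Definition dagger_map : {linear dagger F' -> dagger F} := precomp conj_map.

Definition fulldual_fun (l : fulldual F') : fulldual F := precomp res_map l.
Lemma fulldual_fun_is_linear : linear fulldual_fun.
Proof.
move=> r l l'; apply: linP => m /=.
by rewrite /fd_scale_fun /res_map linearZ.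
Qed.
HB.instance Definition _ := GRing.isLinear.Build R (fulldual F') (fulldual F) *:%R
  fulldual_fun fulldual_fun_is_linear.
Definition fulldual_map : {linear fulldual F' -> fulldual F} := fulldual_fun.

End DualMaps.

Section Embedding.
Context (F : lmodType R).

Section Trace.
Context (l : dagger F).
Definition tr_comp (m : resmod F) : K^o := ga_tr ((l : {linear _ -> _}) (m : conjmod F)).
Lemma tr_comp_is_linear : linear tr_comp.
Proof.
move=> c m n; rewrite /tr_comp.
have -> : (c *: m + n : resmod F) =
    ga_const G c *: (m : conjmod F) + (n : conjmod F) :> conjmod F.
  by rewrite conjmodE ga_conj_const.
rewrite (linearP (l : {linear conjmod F -> R^o})) raddfD.
by congr (_ + _); apply: ga_tr_const.
Qed.
HB.instance Definition _ := GRing.isLinear.Build K (resmod F) K^o *:%R tr_comp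
  tr_comp_is_linear.
End Trace.

Definition dual_embed_fun (l : dagger F) : fulldual F := (tr_comp l : {linear _ -> _}).
Lemma dual_embed_is_linear : linear dual_embed_fun.
Proof.
move=> r l l'; apply: linP => m; rewrite /= /tr_comp raddfD; congr (_ + _).
exact: (congr1 (@ga_tr K G) (esym (linearZ_LR (l : {linear conjmod F -> R^o}) r m))).
Qed.
HB.instance Definition _ := GRing.isLinear.Build R (dagger F) (fulldual F) *:%R
  dual_embed_fun dual_embed_is_linear.
Definition dual_embed : {linear dagger F -> fulldual F} := dual_embed_fun.

Lemma dual_embedE (l : dagger F) (m : F) :
  (dual_embed l : {linear resmod F -> K^o}) m =
  ga_tr ((l : {linear conjmod F -> R^o}) m).
Proof. by []. Qed.
End Embedding.

Lemma fulldual_map_embed (F F' : lmodType R) (d : {linear F -> F'}) (l : dagger F') :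
  fulldual_map d (dual_embed F' l) = dual_embed F (dagger_map d l).
Proof. exact: linP. Qed.

Definition dagger_cap_im (F1 F0 : lmodType R) (d1 : {linear F1 -> F0}) :
  submodule (fulldual F1) :=
  submod_cap (submod_range (dual_embed F1)) (submod_range (fulldual_map d1)).

Definition im_dagger (F1 F0 : lmodType R) (d1 : {linear F1 -> F0}) :
  submodule (fulldual F1) :=
  submod_image (dual_embed F1) (submod_range (dagger_map d1)).

Lemma im_dagger_sub (F1 F0 : lmodType R) (d1 : {linear F1 -> F0}) :
  {subset im_dagger d1 <= dagger_cap_im d1}.
Proof.
move=> l; rewrite !inE => /asboolP[k /[!inE]/asboolP[m _ <-] <-].
apply/andP; split; apply/asboolP; first by exists (dagger_map d1 m).
by exists (dual_embed F0 m); rewrite // fulldual_map_embed.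
Qed.

(* The submodules live in F_1^* , so im d_1^dagger is taken through dual_embed. *)
Definition superselection_sectors (F1 F0 : lmodType R) (d1 : {linear F1 -> F0}) :
  lmodType R := subquot (dagger_cap_im d1) (im_dagger d1).

End Duals.

Definition Laurent (N D : nat) : comPzRingType := grpalg (Zmod N) 'rV[int]_D.

(* Main.v *)
(* A functional l in F_1^dagger is recovered from its trace, so it is killed by    *)
(* d_2^dagger iff tr o l vanishes on im d_2 = ker d_1, that is, iff tr o l factors *)
(* through im d_1. Z/NZ is injective over itself (Baer), so such a factorization   *)
(* extends to F_0 and tr o l lies in im d_1^*. Hence the superselection sectors    *)
(* are ker d_2^dagger / im d_1^dagger. Conjugation being exact and preserving free *)
(* modules, this is the first cohomology of Hom (-, R) on the start                *)
(* conj F_2 -> conj F_1 -> conj F_0 of a resolution of conj (coker d_1). It agrees *)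
(* with Ext^1, since lifts and homotopies in degrees 0 and 1 are enough to compare *)
(* H^1.                                                                            *)
From HB Require Import structures.
Require Import Defs.
From mathcomp Require Import all_boot all_order all_algebra.
From mathcomp Require Import boolp classical_sets finmap.
From mathcomp.multinomials Require Import monalg.

Set Implicit Arguments.
Unset Strict Implicit.
Unset Printing Implicit Defensive.

Import GRing.Theory.
Local Open Scope ring_scope.

(** The kernel formula compares two kinds of functional. By [tr_linear_eq0], an $R$-linear
    functional vanishes at a point once its trace vanishes on the cyclic submodule generated there,
    so nothing is lost in passing from $l$ to $\operatorname{tr}\circ l$. By [Zmod_extend], a
    $\mathbb Z_N$-functional killing $\ker d_1$ factors through $d_1$. Together they give
    [dagger_ker_cap_im]. For the isomorphism, [sectors_iso] turns the sectors into an $H^1$ of Hom,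
    and [hom_H1_iso] compares it with [Ext]. *)

Section ZmodSelfInjective.

(** * Self-injectivity of $\mathbb Z_N$ *)

Context (N : nat) (N_gt0 : (0 < N)%N).
Local Notation K := (Zmod N).

Lemma Zmod_natE (a : nat) : (a%:R : K) = (a %% N)%N :> nat.
Proof.
have -> : (a%:R : K) = (Zp1 : 'I_N.-1.+1) *+ a by [].
by rewrite Zp_mulrn /= modnMml mul1n prednK.
Qed.

Lemma Zmod_natK (c : K) : (c : nat)%:R = c.
Proof.
apply: val_inj; rewrite /= Zmod_natE modn_small //.
by rewrite -[X in (_ < X)%N](prednK N_gt0); apply: (ltn_ord (c : 'I_N.-1.+1)).
Qed.

Lemma Zmod_nat_eq0 (a : nat) : (a%:R == 0 :> K) = (N %| a)%N.
Proof. by rewrite -val_eqE /= Zmod_natE /dvdn. Qed.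

Lemma Zmod_char : N%:R = 0 :> K.
Proof. by apply/eqP; rewrite Zmod_nat_eq0. Qed.

(* [G] is the graph of a partial linear map on [W]. The [c] with [c *: w] in its   *)
(* domain form an ideal generated by a divisor [n] of [N], and the value at        *)
(* [n%:R *: w] is killed by [N %/ n], hence a multiple of [n].                     *)
Lemma Zmod_baer (W : lmodType K) (G : set (W * K^o)) (w : W) :
  G 0 -> (forall a p q, G p -> G q -> G (a *: p + q)) ->
  (forall k, G (0, k) -> k = 0) ->
  exists k : K^o, forall (c : K) (j : K^o), G (c *: w, j) -> j = c *: k.
Proof.
move=> G0 Glin Gfun.
have GZ a p : G p -> G (a *: p) by move=> Gp; rewrite -[_ *: _]addr0; apply: Glin.
have GB p q : G p -> G q -> G (p - q).
  by move=> Gp Gq; rewrite addrC -scaleN1r; apply: Glin.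
pose I n := `[< (0 < n)%N /\ exists j, G (n%:R *: w, j) >].
have exI : exists n, I n.
  exists N; apply/asboolP; split=> //; exists 0.
  by rewrite Zmod_char scale0r.
case: (ex_minnP exI) => n /asboolP[n_gt0 [j0 Gj0]] n_min.
have n_dvd a j : G (a%:R *: w, j) -> (n %| a)%N.
  move=> Ga; rewrite /dvdn -leqn0 leqNgt; apply/negP => r_gt0.
  suff /n_min : I (a %% n)%N by rewrite leqNgt ltn_mod n_gt0.
  apply/asboolP; split=> //; exists (j - (a %/ n)%:R *: j0).
  have := GB _ _ Ga (GZ (a %/ n)%:R _ Gj0); congr (G (_, _)) => /=.
  by rewrite scalerA -scalerBl {1}(divn_eq a n) natrD natrM addrAC subrr add0r.
have [k j0E] : exists k : K^o, j0 = n%:R *: k.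
  have NE : N = (N %/ n * n)%N.
    by rewrite divnK //; apply: (@n_dvd _ 0); rewrite Zmod_char scale0r.
  have m_gt0 : (0 < N %/ n)%N by move: N_gt0; rewrite {1}NE muln_gt0 => /andP[].
  have /Gfun : G (0, (N %/ n)%:R *: j0).
    have := GZ (N %/ n)%:R _ Gj0; congr (G (_, _)) => /=.
    by rewrite scalerA -natrM -NE Zmod_char scale0r.
  rewrite -[j0]Zmod_natK => /eqP.
  rewrite -[_ *: _]natrM Zmod_nat_eq0 {1}NE dvdn_pmul2l // => n_dvd_j0.
  exists ((j0 : nat) %/ n)%:R.
  by rewrite -[_ *: _]natrM mulnC divnK.
exists k => c j Gc.
have cE : c = ((c : nat) %/ n)%:R * n%:R.
  by rewrite -natrM divnK ?Zmod_natK //; apply: (@n_dvd _ j); rewrite Zmod_natK.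
(* Subtracting [c %/ n] times [(n%:R *: w, j0)] cancels the first coordinate, so [Gfun] applies to
   what remains. *)
have := GB _ _ Gc (GZ ((c : nat) %/ n)%:R _ Gj0).
rewrite [X in G X](_ : _ = (0, j - c *: k)).
  by move/Gfun/eqP; rewrite subr_eq0 => /eqP.
by congr (_, _) => /=; rewrite ?j0E scalerA -cE // subrr.
Qed.

(** The kernel condition makes the pairs [(f x, g x)] the graph of a functional on
    $\operatorname{im} f$. Zorn's lemma gives a maximal extension, and [Zmod_baer] could enlarge any
    extension not defined on all of [W]. *)
Lemma Zmod_extend (V W : lmodType K) (f : {linear V -> W}) (g : {linear V -> K^o}) :
  (forall x, f x = 0 -> g x = 0) ->
  exists h : {linear W -> K^o}, forall x, h (f x) = g x.
Proof.
move=> kerfg.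
(* Graphs of partial extensions; the last clause lets [P] hold of [set0], the      *)
(* union of the empty chain.                                                       *)
pose P (G : set (W * K^o)) :=
  [/\ forall a p q, G p -> G q -> G (a *: p + q),
      forall k, G (0, k) -> k = 0 &
      forall p x, G p -> G (f x, g x)].
have [F FP Ftot|G [[Glin Gfun Ggraph] Gmax]] := @Zorn_bigcup _ P.
  split.
  - move=> a p q [X FX Xp] [Y FY Yq].
    have [XY|YX] := Ftot _ _ FX FY.
      by exists Y => //; have [Ylin _ _] := FP _ FY; apply: Ylin => //; apply: XY.
    by exists X => //; have [Xlin _ _] := FP _ FX; apply: Xlin => //; apply: YX.
  - by move=> k [X FX Xk]; have [_ Xfun _] := FP _ FX; apply: Xfun.
  - by move=> p x [X FX Xp]; exists X => //; have [_ _ Xg] := FP _ FX; apply: Xg Xp.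
(* A maximal [G] is not empty: the graph of $g$ over $\operatorname{im} f$ would be strictly
   larger. *)
have Gfg x : G (f x, g x).
  have [[p Gp]|/forallNP Gempty] := pselect (exists p, G p); first exact: Ggraph Gp.
  case: (Gmax [set p | exists x, p = (f x, g x)]%classic).
    split=> [p /Gempty //|Gsub].
    by apply: (Gempty (f 0, g 0)); apply: Gsub; exists 0.
  split=> [a _ _ [y ->] [z ->]|k [y [fy ->]]|_ y _]; last by exists y.
    by exists (a *: y + z); rewrite !linearP.
  by apply: kerfg; rewrite -fy.
have G0 : G 0 by have := Gfg 0; rewrite !linear0.
have Gtot w : exists k, G (w, k).
  have [k kP] := Zmod_baer w G0 Glin Gfun; exists k; apply: contrapT => Gwk.
  case: (Gmax [set p | exists c q, G q /\ p = c *: (w, k) + q]%classic).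
    split=> [p Gp|Gsub]; first by exists 0, p; rewrite scale0r add0r.
    by apply: Gwk; apply: Gsub; exists 1, 0; rewrite scale1r addr0.
  split.
  - move=> a _ _ [c [q [Gq ->]]] [c' [q' [Gq' ->]]].
    exists (a * c + c'), (a *: q + q'); split; first exact: Glin.
    by rewrite scalerDr scalerA scalerDl addrACA.
  (* If $cw + y = 0$ with [(y, i)] in [G], then $y = -cw$, and the choice of [k] forces $i =
     -ck$. *)
  - move=> j [c [[y i] [Gq [/esym/eqP yE ->]]]].
    move: yE; rewrite addrC addr_eq0 -scaleNr => /eqP yE; rewrite yE in Gq.
    by rewrite (kP _ _ Gq) /= scaleNr subrr.
  - by move=> _ x _; exists 0, (f x, g x); rewrite scale0r add0r.
have [h hP] := choice Gtot.
have Guniq w j k : G (w, j) -> G (w, k) -> j = k.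
  move=> Gj Gk; apply/eqP; rewrite -subr_eq0; apply/eqP; apply: Gfun.
  have := Glin (-1) _ _ Gk Gj; congr (G (_, _)) => /=.
    by rewrite scaleN1r addNr.
  by rewrite scaleN1r addrC.
have h_linear : linear h.
  by move=> a x y; apply: Guniq (hP _) _; apply: (Glin a (x, h x) (y, h y)).
pose hL := GRing.isLinear.Build _ _ _ _ h h_linear.
pose h' : {linear W -> K^o} := HB.pack h hL.
by exists h' => x; apply: Guniq (hP _) (Gfg x).
Qed.

End ZmodSelfInjective.

(** * Submodules, subquotients and lifting from projectives *)

Section SubmoduleMembership.
Context (S : pzRingType) (U V : lmodType S).

Lemma submod_kerP (f : {linear U -> V}) x : reflect (f x = 0) (x \in submod_ker f).
Proof. by rewrite inE; apply: eqP. Qed.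

Lemma submod_imageP (f : {linear U -> V}) (A : submodule U) y :
  reflect (exists2 x, x \in A & f x = y) (y \in submod_image f A).
Proof. by rewrite inE; apply: asboolP. Qed.

Lemma submod_rangeP (f : {linear U -> V}) y :
  reflect (exists x, f x = y) (y \in submod_range f).
Proof.
by apply: (iffP (submod_imageP f _ y)) => [[x _ <-]|[x <-]]; exists x.
Qed.

End SubmoduleMembership.

Lemma exact_atP (S : pzRingType) (U V W : lmodType S) (f : {linear U -> V})
    (g : {linear V -> W}) :
  exact_at f g <-> forall y, g y = 0 <-> exists x, f x = y.
Proof.
split=> fg y; last by apply/submod_rangeP/submod_kerP => /fg.
by split=> [/submod_kerP|/submod_rangeP]; [rewrite -fg|rewrite fg];
   [move/submod_rangeP|move/submod_kerP].
Qed.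

Section LmodIso.
Context (S : pzRingType).
Implicit Types U V W : lmodType S.

Lemma linear_bij_inv U V (f : {linear U -> V}) :
  bijective f -> exists g : {linear V -> U}, cancel f g /\ cancel g f.
Proof.
move=> [g fK gK].
have g_linear : linear g by move=> a x y; apply: (can_inj fK); rewrite linearP !gK.
pose gL := GRing.isLinear.Build _ _ _ _ g g_linear.
by exists (HB.pack g gL : {linear V -> U}).
Qed.

Lemma lmod_iso_sym U V : lmod_iso U V -> lmod_iso V U.
Proof. by move=> [f /linear_bij_inv[g [fK gK]]]; exists g, f. Qed.

Lemma lmod_iso_trans U V W : lmod_iso U V -> lmod_iso V W -> lmod_iso U W.
Proof.
by move=> [f f_bij] [g g_bij]; exists (g \o f : {linear U -> W}); apply: bij_comp.
Qed.

Lemma inj_surj_bij (X Y : Type) (f : X -> Y) :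
  injective f -> (forall y, exists x, f x = y) -> bijective f.
Proof. by move=> f_inj /choice[g gK]; exists g => // x; apply: f_inj. Qed.

(** The second hypothesis gives both well-definedness and injectivity of the map induced by [f]; the
    third gives surjectivity. *)
Lemma subquot_iso U V (A B : submodule U) (C D : submodule V) (f : {linear U -> V}) :
  {in A, forall x, f x \in C} ->
  {in A, forall x, (f x \in D) = (x \in B)} ->
  {in C, forall y, exists2 x, x \in A & f x - y \in D} ->
  lmod_iso (subquot A B) (subquot C D).
Proof.
move=> fAC fDB fsurj.
pose fA (x : submod_type A) : submod_type C := SubmodElt (fAC _ (valP x)).
pose pA := @qm_pi S _ (submod_restr A B).
pose pC := @qm_pi S _ (submod_restr C D).
pose F (q : subquot A B) : subquot C D := pC (fA (repr q)).
have Fpi x : F (pA x) = pC (fA x).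
  apply/qm_pi_eq; rewrite inE.
  change (f (val (repr (pA x))) - f (val x) \in D).
  rewrite -linearB -[_ - _]/(val (repr (pA x) - x)) fDB; last exact: valP.
  have : pA (repr (pA x)) = pA x by rewrite /pA qm_piK.
  by move/qm_pi_eq; rewrite inE.
have F_linear : linear F.
  move=> a q r; rewrite -(qm_piK q) -(qm_piK r) -linearP Fpi !Fpi -linearP.
  by congr (pC _); apply: val_inj; apply: (linearP f).
pose FL := GRing.isLinear.Build _ _ _ _ F F_linear.
exists (HB.pack F FL : {linear _ -> _}); apply: inj_surj_bij => [q r|y].
  rewrite /= -(qm_piK q) -(qm_piK r) !Fpi => /qm_pi_eq /=; rewrite inE.
  set x := repr q; set z := repr r => xz; apply/qm_pi_eq; rewrite inE.
  have : f (val (x - z)) \in D by rewrite linearB.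
  by rewrite fDB //; apply: valP.
have [x Ax fxy] := fsurj _ (valP (repr y)).
exists (pA (SubmodElt Ax)); rewrite /= Fpi -[RHS]qm_piK.
by apply/qm_pi_eq; rewrite inE.
Qed.

End LmodIso.

(** Exactness makes the corestriction of [f] to $\ker g$ surjective, and [h] lands in that
    kernel. *)
Lemma projective_lift (S : pzRingType) (P U V W : lmodType S) (f : {linear U -> V})
    (g : {linear V -> W}) (h : {linear P -> V}) :
  projective P -> exact_at f g -> (forall x, g (h x) = 0) ->
  exists k : {linear P -> U}, forall x, f (k x) = h x.
Proof.
move=> P_proj /exact_atP fg gh.
pose A := submod_ker g.
pose h' x : submod_type A := SubmodElt (introT (submod_kerP g (h x)) (gh x)).
have h'_linear : linear h' by move=> a x y; apply: val_inj; rewrite /= linearP.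
have f_ker x : f x \in A by apply/submod_kerP/fg; exists x.
pose f' x : submod_type A := SubmodElt (f_ker x).
have f'_linear : linear f' by move=> a x y; apply: val_inj; rewrite /= linearP.
pose h'L := GRing.isLinear.Build _ _ _ _ h' h'_linear.
pose f'L := GRing.isLinear.Build _ _ _ _ f' f'_linear.
have f'_surj y : exists x, (HB.pack f' f'L : {linear _ -> _}) x = y.
  have [x fx] : exists x, f x = val y by apply/fg/submod_kerP/valP.
  by exists x; apply: val_inj.
have [k kP] := P_proj _ _ _ (HB.pack h' h'L : {linear _ -> _}) f'_surj.
by exists k => x; have /(congr1 val) := kP x.
Qed.

Lemma finite_free_projective (S : pzRingType) (F : lmodType S) :
  finite_free F -> projective F.
Proof.
move=> [n [b b_bij]] U V g f g_surj.
pose e (c : 'rV[S]_n) : F := \sum_i c 0 i *: b i.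
have e_linear : linear e.
  move=> a x y; rewrite scaler_sumr -big_split; apply: eq_bigr => i _ /=.
  by rewrite !mxE scalerDl scalerA.
pose eL := GRing.isLinear.Build _ _ _ _ e e_linear.
have [c [eK cK]] := @linear_bij_inv _ _ _ (HB.pack e eL : {linear _ -> _}) b_bij.
have [s sP] := choice (fun i => g_surj (f (b i))).
pose h x : U := \sum_i c x 0 i *: s i.
have h_linear : linear h.
  move=> a x y; rewrite scaler_sumr -big_split; apply: eq_bigr => i _ /=.
  by rewrite linearP !mxE scalerDl scalerA.
pose hL := GRing.isLinear.Build _ _ _ _ h h_linear.
exists (HB.pack h hL : {linear _ -> _}) => x /=.
rewrite linear_sum -[in RHS](cK x) linear_sum; apply: eq_bigr => i _ /=.
by rewrite !linearZ /= sP.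
Qed.

(** * Independence of $H^1$ from the resolution *)

Section ComparisonH1.
Context (S : comPzRingType) (M N : lmodType S).

Lemma chain_lift (P1 P0 Q1 Q0 : lmodType S)
    (p1 : {linear P1 -> P0}) (p0 : {linear P0 -> M})
    (q1 : {linear Q1 -> Q0}) (q0 : {linear Q0 -> M}) :
  projective P1 -> projective P0 -> (forall x, p0 (p1 x) = 0) ->
  exact_at q1 q0 -> (forall m, exists x, q0 x = m) ->
  exists (f1 : {linear P1 -> Q1}) (f0 : {linear P0 -> Q0}),
    (forall x, q1 (f1 x) = f0 (p1 x)) /\ (forall x, q0 (f0 x) = p0 x).
Proof.
move=> P1_proj P0_proj pp q_ex q_surj.
have [f0 f0P] := P0_proj _ _ q0 p0 q_surj.
have [f1 f1P] := @projective_lift _ _ _ _ _ _ _ (f0 \o p1 : {linear P1 -> Q0})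
  P1_proj q_ex (fun x => etrans (f0P _) (pp x)).
by exists f1, f0.
Qed.

(* A homotopy [s] in degree 0 suffices: [e1 - 1 - s p1] lands in [ker p1 = im p2], *)
(* where a cocycle vanishes.                                                      *)
Lemma cocycle_homotopy (P2 P1 P0 : lmodType S) (p2 : {linear P2 -> P1})
    (p1 : {linear P1 -> P0}) (p0 : {linear P0 -> M})
    (e1 : {linear P1 -> P1}) (e0 : {linear P0 -> P0}) (phi : {linear P1 -> N}) :
  projective P0 -> exact_at p1 p0 -> exact_at p2 p1 ->
  (forall x, p1 (e1 x) = e0 (p1 x)) -> (forall x, p0 (e0 x) = p0 x) ->
  phi \in submod_ker (precomp p2 : {linear _ -> {linear _ -> N}}) ->
  precomp e1 phi - phi \in submod_range (precomp p1 : {linear _ -> {linear _ -> N}}).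
Proof.
move=> P0_proj ex1 ex2 e10 e0p /submod_kerP phi_p2.
have [s sP] := @projective_lift _ _ _ _ _ _ _ (e0 \- idfun : {linear P0 -> P0})
  P0_proj ex1 (fun x => etrans (linearB p0 _ _)
    (etrans (congr1 (fun y => y - p0 x) (e0p x)) (subrr _))).
apply/submod_rangeP; exists (precomp s phi); apply: linP => x /=.
apply/eqP; rewrite eq_sym -subr_eq0 -!linearB; apply/eqP.
have /(exact_atP p2 p1).1 [//|y <-] : p1 (e1 x - x - s (p1 x)) = 0.
  by rewrite !linearB /= e10 sP /= subrr.
exact: (congr1 (fun l : {linear P2 -> N} => l y) phi_p2).
Qed.

(** The identity of [M] lifts to chain maps $f : Q \to P$ and $g : P \to Q$ in degrees 0 and 1. Both
    composites are homotopic to the identity on cocycles, so [precomp f1] and [precomp g1] are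
    mutually inverse on $H^1$. *)
Lemma hom_H1_iso (P2 P1 P0 Q2 Q1 Q0 : lmodType S)
    (p2 : {linear P2 -> P1}) (p1 : {linear P1 -> P0}) (p0 : {linear P0 -> M})
    (q2 : {linear Q2 -> Q1}) (q1 : {linear Q1 -> Q0}) (q0 : {linear Q0 -> M}) :
  projective P1 -> projective P0 -> projective Q1 -> projective Q0 ->
  exact_at p2 p1 -> exact_at p1 p0 -> (forall m, exists x, p0 x = m) ->
  exact_at q2 q1 -> exact_at q1 q0 -> (forall m, exists x, q0 x = m) ->
  lmod_iso
    (subquot (submod_ker (precomp p2 : {linear _ -> {linear _ -> N}}))
             (submod_range (precomp p1 : {linear _ -> {linear _ -> N}})))
    (subquot (submod_ker (precomp q2 : {linear _ -> {linear _ -> N}}))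
             (submod_range (precomp q1 : {linear _ -> {linear _ -> N}}))).
Proof.
move=> P1_proj P0_proj Q1_proj Q0_proj p_ex1 p_ex0 p_surj q_ex1 q_ex0 q_surj.
have pp x : p0 (p1 x) = 0 by apply/((exact_atP _ _).1 p_ex0); exists x.
have qq x : q0 (q1 x) = 0 by apply/((exact_atP _ _).1 q_ex0); exists x.
have [f1 [f0 [f10 f0p]]] := chain_lift Q1_proj Q0_proj qq p_ex0 p_surj.
have [g1 [g0 [g10 g0p]]] := chain_lift P1_proj P0_proj pp q_ex0 q_surj.
have cocycle (A2 A1 A0 B2 B1 B0 : lmodType S) (a2 : {linear A2 -> A1})
    (a1 : {linear A1 -> A0}) (b2 : {linear B2 -> B1}) (b1 : {linear B1 -> B0})
    (h1 : {linear A1 -> B1}) (h0 : {linear A0 -> B0}) (phi : {linear B1 -> N}) :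
    exact_at a2 a1 -> exact_at b2 b1 -> (forall x, b1 (h1 x) = h0 (a1 x)) ->
    phi \in submod_ker (precomp b2 : {linear _ -> {linear _ -> N}}) ->
    precomp h1 phi \in submod_ker (precomp a2 : {linear _ -> {linear _ -> N}}).
  move=> /exact_atP a_ex /exact_atP b_ex h10 /submod_kerP phi_b2.
  apply/submod_kerP/linP => x /=.
  (* By exactness a cocycle is a map vanishing on $\ker b_1$, so a chain map in degree 2 is
     avoided. *)
  have /b_ex[y <-] : b1 (h1 (a2 x)) = 0.
    by rewrite h10 (_ : a1 _ = 0) ?linear0 //; apply/a_ex; exists x.
  exact: (congr1 (fun l : {linear B2 -> N} => l y) phi_b2).
have coboundary (A1 A0 B1 B0 : lmodType S) (a1 : {linear A1 -> A0})
    (b1 : {linear B1 -> B0}) (h1 : {linear A1 -> B1}) (h0 : {linear A0 -> B0})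
    (phi : {linear B1 -> N}) : (forall x, b1 (h1 x) = h0 (a1 x)) ->
    phi \in submod_range (precomp b1 : {linear _ -> {linear _ -> N}}) ->
    precomp h1 phi \in submod_range (precomp a1 : {linear _ -> {linear _ -> N}}).
  move=> h10 /submod_rangeP[psi <-]; apply/submod_rangeP.
  by exists (precomp h0 psi); apply: linP => x /=; rewrite h10.
have fg_hom (phi : {linear P1 -> N}) :
    phi \in submod_ker (precomp p2 : {linear _ -> {linear _ -> N}}) ->
    precomp g1 (precomp f1 phi) - phi
      \in submod_range (precomp p1 : {linear _ -> {linear _ -> N}}).
  rewrite (_ : precomp g1 _ = precomp (f1 \o g1 : {linear _ -> _}) phi);
    last exact: linP.
  apply: (@cocycle_homotopy _ _ _ _ _ _ (f1 \o g1 : {linear _ -> _})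
      (f0 \o g0 : {linear _ -> _}) _ P0_proj p_ex0 p_ex1) => x /=.
    by rewrite f10 g10.
  by rewrite f0p g0p.
have gf_hom (phi : {linear Q1 -> N}) :
    phi \in submod_ker (precomp q2 : {linear _ -> {linear _ -> N}}) ->
    precomp f1 (precomp g1 phi) - phi
      \in submod_range (precomp q1 : {linear _ -> {linear _ -> N}}).
  rewrite (_ : precomp f1 _ = precomp (g1 \o f1 : {linear _ -> _}) phi);
    last exact: linP.
  apply: (@cocycle_homotopy _ _ _ _ _ _ (g1 \o f1 : {linear _ -> _})
      (g0 \o f0 : {linear _ -> _}) _ Q0_proj q_ex0 q_ex1) => x /=.
    by rewrite g10 f10.
  by rewrite g0p f0p.
apply: (@subquot_iso _ _ _ _ _ _ _ (precomp f1)) => [phi|phi phi_p2|phi phi_q2].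
- exact: cocycle q_ex1 p_ex1 f10.
- apply/idP/idP => [/(coboundary _ _ _ _ _ _ _ _ _ g10) phi_fg|].
    (* Injectivity: [phi] is its round trip, now a coboundary, minus the homotopy defect
       [fg_hom]. *)
    rewrite -[phi](subKr (precomp g1 (precomp f1 phi))).
    by apply: rpredB (fg_hom _ phi_p2).
  exact: coboundary f10.
- exists (precomp g1 phi); first exact: (cocycle _ _ _ _ _ _ _ _ _ _ _ _ _ p_ex1 q_ex1 g10).
  exact: gf_hom.
Qed.

End ComparisonH1.

(** * Trace pairing, conjugation and superselection sectors *)

Section Duals.
Context (K : comPzRingType) (G : zmodType).
Local Notation R := (grpalg K G).

(** Taking $r = x^{-v}$ reads off the coefficient at $v$. *)
Lemma ga_tr_nondegenerate (x : R) : (forall r : R, ga_tr (r * x) = 0) -> x = 0.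
Proof.
move=> tr0; apply/malgP => v; rewrite mcoeff0.
have := tr0 << (1 : K) *g (- v) >>.
rewrite /ga_tr [_ * _]ga_mulUg raddf_sum /= => <-.
rewrite [in LHS](monalgE x) raddf_sum; apply: eq_bigr => w _ /=.
by rewrite !mcoeffU mul1r addrC subr_eq0.
Qed.

Lemma tr_linear_eq0 (M : lmodType R) (l : {linear M -> R^o}) x :
  (forall r : R, ga_tr (l (r *: x)) = 0) -> l x = 0.
Proof.
by move=> tr0; apply: ga_tr_nondegenerate => r; rewrite -[RHS](tr0 r) linearZ.
Qed.

Lemma dual_embed_inj (F : lmodType R) : injective (dual_embed F).
Proof.
move=> l l' ll'; apply/eqP; rewrite -subr_eq0; apply/eqP; apply: linP => m.
apply: tr_linear_eq0 => r.
have /(congr1 (fun k : {linear resmod F -> K^o} => k (r *: m))) :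
  dual_embed F (l - l') = 0 by rewrite linearB ll' subrr.
exact.
Qed.

Lemma exact_at_conj (F2 F1 F0 : lmodType R) (d2 : {linear F2 -> F1})
    (d1 : {linear F1 -> F0}) :
  exact_at d2 d1 ->
  exact_at (conj_map d2 : {linear conjmod F2 -> conjmod F1})
           (conj_map d1 : {linear conjmod F1 -> conjmod F0}).
Proof. by move=> /exact_atP d_ex; apply/exact_atP. Qed.

Lemma exact_at_coker (F1 F0 : lmodType R) (d1 : {linear F1 -> F0}) :
  exact_at d1 (@qm_pi _ _ (submod_range d1)).
Proof.
apply/exact_atP => y; split=> [|yP].
  rewrite -[0](raddf0 (@qm_pi _ _ (submod_range d1))) => /qm_pi_eq.
  by rewrite subr0 => /submod_rangeP.
rewrite -[RHS](raddf0 (@qm_pi _ _ (submod_range d1))); apply/qm_pi_eq.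
by rewrite subr0; apply/submod_rangeP.
Qed.

(** The same basis works, with conjugated coordinates. *)
Lemma finite_free_conj (F : lmodType R) : finite_free F -> finite_free (conjmod F).
Proof.
move=> [n [b b_bij]]; exists n, b.
pose e (c : 'rV[R]_n) := map_mx (@ga_conj K G) c.
have eK : involutive e by move=> c; apply/rowP => i; rewrite !mxE ga_conjK.
have eE c : \sum_i e c 0 i *: b i = \sum_i c 0 i *: (b i : conjmod F) :> F.
  by apply: eq_bigr => i _; rewrite mxE.
exact: (eq_bij (bij_comp b_bij (inv_bij eK)) eE).
Qed.

Section Sectors.
Context (F2 F1 F0 : lmodType R) (d2 : {linear F2 -> F1}) (d1 : {linear F1 -> F0}).
Context (d_exact : exact_at d2 d1).

(* The form in which self-injectivity of [K] is used; it holds for K = Z/NZ. *)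
Context (extend : forall g : {linear resmod F1 -> K^o},
  (forall x, res_map d1 x = 0 -> g x = 0) ->
  exists h : {linear resmod F0 -> K^o}, forall x, h (res_map d1 x) = g x).

(** If $\operatorname{tr}\circ l = \mu\circ d_1$, the trace of $l$ vanishes on the $R$-submodule
    $\operatorname{im} d_2$, hence so does $l$. Conversely, if $l$ kills $\operatorname{im} d_2 =
    \ker d_1$, so does its trace, and [extend] supplies $\mu$. *)
Lemma dagger_ker_cap_im l :
  (dual_embed F1 l \in submod_range (fulldual_map d1)) =
  (l \in submod_ker (dagger_map d2)).
Proof.
have d_ex := (exact_atP d2 d1).1 d_exact.
apply/submod_rangeP/submod_kerP => [[mu muE]|l_d2].
  apply: linP => x; apply: (@tr_linear_eq0 (conjmod F2)) => r.
  have /(congr1 (fun k : {linear resmod F1 -> K^o} => k (conj_map d2 (r *: x)))) := muE.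
  move=> muE'; apply: etrans (esym muE') _; rewrite /= /res_map /=.
  rewrite (_ : d1 _ = 0); last by apply/d_ex; exists (r *: x).
  exact: (linear0 (mu : {linear resmod F0 -> K^o})).
have [x d1x|h hP] := extend (g := dual_embed F1 l).
  have /d_ex[y <-] : d1 x = 0 by [].
  have /(congr1 (fun k : {linear conjmod F2 -> R^o} => ga_tr (k y))) := l_d2.
  by move=> e; rewrite /= [LHS]e; apply: raddf0.
by exists h; apply: linP.
Qed.

Lemma dagger_ker_image :
  submod_image (dual_embed F1) (submod_ker (dagger_map d2)) =i dagger_cap_im d1.
Proof.
move=> mu; apply/submod_imageP/andP => [[l l_d2 <-]|[/submod_rangeP[l <-]]].
  by rewrite dagger_ker_cap_im; split=> //; apply/submod_rangeP; exists l.
by rewrite dagger_ker_cap_im => l_d2; exists l.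
Qed.

(** The map is [dual_embed]; its injectivity ensures that only elements of $\operatorname{im}
    d_1^\dagger$ land in [im_dagger d1]. *)
Lemma sectors_iso :
  lmod_iso (subquot (submod_ker (dagger_map d2)) (submod_range (dagger_map d1)))
           (superselection_sectors d1).
Proof.
apply: (@subquot_iso _ _ _ _ _ _ _ (dual_embed F1)) => [l l_d2|l _|mu].
- by rewrite -dagger_ker_image; apply/submod_imageP; exists l.
- by apply/submod_imageP/idP => [[k k_d1 /dual_embed_inj <-]|l_d1] //; exists l.
- rewrite -dagger_ker_image => /submod_imageP[l l_d2 <-].
  by exists l => //; rewrite subrr rpred0.
Qed.

Lemma sectors_Ext (P : proj_resolution (conjmod (coker d1))) :
  finite_free F1 -> finite_free F0 ->
  lmod_iso (superselection_sectors d1) (Ext P R^o 1).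
Proof.
move=> F1_free F0_free.
apply: lmod_iso_trans (lmod_iso_sym sectors_iso) _.
(* The conjugate of $F_2 \to F_1 \to F_0 \to \operatorname{coker} d_1$ serves as the start of a
   resolution, since $F^\dagger$ is by definition Hom from the conjugate of $F$ to $R$. *)
apply: (@hom_H1_iso _ (conjmod (coker d1)) R^o
  (conjmod F2) (conjmod F1) (conjmod F0) _ _ _
  (conj_map d2) (conj_map d1) (conj_map (@qm_pi _ _ (submod_range d1)))
  (pr_diff P 1) (pr_diff P 0) (pr_aug P)).
- exact/finite_free_projective/finite_free_conj.
- exact/finite_free_projective/finite_free_conj.
- exact: pr_projective.
- exact: pr_projective.
- exact: exact_at_conj.
- exact/exact_at_conj/exact_at_coker.
- by move=> q; exists (repr (q : coker d1)); apply: qm_piK.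
- exact: pr_exact.
- exact: pr_exact0.
- exact: pr_aug_surj.
Qed.

End Sectors.
End Duals.

Theorem theorem1 (N D : nat) (N_gt0 : (0 < N)%N)
    (F2 F1 F0 : lmodType (Laurent N D))
    (F2_free : finite_free F2) (F1_free : finite_free F1) (F0_free : finite_free F0)
    (d2 : {linear F2 -> F1}) (d1 : {linear F1 -> F0})
    (exact_F1 : exact_at d2 d1) :
  (submod_image (dual_embed F1) (submod_ker (dagger_map d2)) =i
     submod_cap (submod_range (dual_embed F1)) (submod_range (fulldual_map d1)))
  /\
  (forall P : proj_resolution (conjmod (coker d1)),
     lmod_iso (superselection_sectors d1) (Ext P (Laurent N D)^o 1)).
Proof.
have extend := Zmod_extend N_gt0 (f := res_map d1).
split; first exact: dagger_ker_image extend.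
by move=> P; apply: sectors_Ext extend P F1_free F0_free.
Qed.
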